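(* DENNET does not hold for the field $\mathbb{R}$ of real numbers. That is, it is not true that for every finite set $X$ and every denumerable family $(f_i)_{i\in I}$ and $f$ of formulas in $F(Y,X)$ such that $\bigwedge_{i\in I} f_i \Rightarrow f$ holds in $\mathbb{R}^X$, there is a finite subset $J\subset I$ such that $\bigwedge_{i\in J} f_i\Rightarrow f$ holds in $\mathbb{R}^X$.
   Context: We work in the variety of commutative (associative, unital) $\mathbb{R}$-algebras, so for a finite set $X$ of variables the free algebra is the polynomial ring $\mathbb{R}[X]$, and $\mathbb{R}^X=\mathrm{Hom}(\mathbb{R}[X],\mathbb{R})$ is the affine space. $F(Y,X)$ is the set of first-order (predicate calculus) formulas built from equalities $w=w'$ with $w,w'\in \mathbb{R}[Y\cup X]$ using propositional connectives and the quantifiers $\forall,\exists$ over variables in $Y$, where $Y$ is a countably infinite set of bound variables and the variables in the finite set $X$ are free. Bound variables range over $\mathbb{R}$. A formula is evaluated at each point of $\mathbb{R}^X$ in the usual way. The (possibly infinitary) implication $\bigwedge_{i\in I} f_i\Rightarrow f$ holds in $\mathbb{R}^X$ if every point of $\mathbb{R}^X$ satisfying all $f_i$, $i\in I$, satisfies $f$. DENNET (denumerable noetherianity, for predicate calculus formulas) for $\mathbb{R}$: for every finite $X$, every denumerable (countable) index set $I$ and all $f_i,f\in F(Y,X)$ such that $\bigwedge_{i\in I} f_i\Rightarrow f$ holds in $\mathbb{R}^X$, there is a finite $J\subset I$ such that $\bigwedge_{i\in J} f_i\Rightarrow f$ holds in $\mathbb{R}^X$. *)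

(* Defs.v *)
From HB Require Import structures.
From mathcomp Require Import all_boot all_order all_algebra.
From mathcomp Require Import finmap monalg.
From mathcomp Require Import reals.

Set Implicit Arguments.
Unset Strict Implicit.
Unset Printing Implicit Defensive.

Import GRing.Theory.
Local Open Scope ring_scope.

(* The countably infinite set Y of bound variables is nat. In Y ∪ X (a disjoint
   union), [inl y] is the bound variable y and [inr x] the free variable x.
   {malg R[{cmonom V}]} is the polynomial ring over R in the (possibly
   infinite) set V of variables; [m i] is the exponent of i in the monomial m. *)
Notation fpoly R X := {malg R[{cmonom (nat + X)%type}]}.

Inductive preform (R : comNzRingType) (X : finType) : Type :=
  | Feq of fpoly R X & fpoly R X
  | Fnot of preform R X
  | Fand of preform R X & preform R X
  | For of preform R X & preform R X
  | Fimp of preform R X & preform R X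
  | Fall of nat & preform R X
  | Fex of nat & preform R X.

Section Formulas.
Variables (R : comNzRingType) (X : finType).

Definition occurs (i : nat + X) (w : fpoly R X) : bool :=
  has (fun m : {cmonom (nat + X)%type} => m i != 0%N) (msupp w).

Fixpoint freeY (y : nat) (f : preform R X) : bool :=
  match f with
  | Feq w w' => occurs (inl y) w || occurs (inl y) w'
  | Fnot g => freeY y g
  | Fand g h | For g h | Fimp g h => freeY y g || freeY y h
  | Fall z g | Fex z g => (y != z) && freeY y g
  end.

(* F(Y,X): every occurrence of a variable of Y is bound, so that only the
   variables of X are free. *)
Record formula := Formula {
  formula_val :> preform R X;
  formula_closed : forall y, ~~ freeY y formula_val
}.

Definition assign (v : nat -> R) (p : X -> R) (i : nat + X) : R :=
  match i with inl y => v y | inr x => p x end.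

Definition peval (e : nat + X -> R) (w : fpoly R X) : R :=
  mmap idfun
    (fun m : {cmonom (nat + X)%type} => \prod_(i <- finsupp m) e i ^+ m i) w.

Definition update (v : nat -> R) (y : nat) (a : R) : nat -> R :=
  fun z => if z == y then a else v z.

Fixpoint holds (v : nat -> R) (p : X -> R) (f : preform R X) : Prop :=
  match f with
  | Feq w w' => peval (assign v p) w = peval (assign v p) w'
  | Fnot g => ~ holds v p g
  | Fand g h => holds v p g /\ holds v p h
  | For g h => holds v p g \/ holds v p h
  | Fimp g h => holds v p g -> holds v p h
  | Fall y g => forall a : R, holds (update v y a) p g
  | Fex y g => exists a : R, holds (update v y a) p g
  end.

(* A point of R^X = Hom(R[X], R) is given by its values on the variables. The
   valuation of Y is irrelevant, by [holds_formula] below. *)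
Definition sat (p : X -> R) (f : formula) : Prop := holds (fun=> 0) p f.

Lemma eq_holds (v v' : nat -> R) (p : X -> R) (f : preform R X) :
  (forall y, freeY y f -> v y = v' y) -> holds v p f <-> holds v' p f.
Proof.
have evalE (u u' : nat -> R) (w : fpoly R X) :
    (forall y, occurs (inl y) w -> u y = u' y) ->
  peval (assign u p) w = peval (assign u' p) w.
  move=> eqv; rewrite /peval /mmap; apply: eq_big_seq => m wm.
  congr (_ * _); apply: eq_big_seq => -[y|x] //= my.
  by rewrite eqv //; apply/hasP; exists m => //; rewrite cmE_neq0.
elim: f v v' => /= [w w'|g IH|g IHg h IHh|g IHg h IHh|g IHg h IHh|z g IH|z g IH]
  v v' eqv.
- rewrite (evalE v v' w) ?(evalE v v' w') // => y yw.
  + by apply: eqv; rewrite yw orbT.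
  + by apply: eqv; rewrite yw.
- by have := IH _ _ eqv; tauto.
- have := IHg v v' (fun y H => eqv y (introT orP (or_introl H))).
  by have := IHh v v' (fun y H => eqv y (introT orP (or_intror H))); tauto.
- have := IHg v v' (fun y H => eqv y (introT orP (or_introl H))).
  by have := IHh v v' (fun y H => eqv y (introT orP (or_intror H))); tauto.
- have := IHg v v' (fun y H => eqv y (introT orP (or_introl H))).
  by have := IHh v v' (fun y H => eqv y (introT orP (or_intror H))); tauto.
- have upd a : holds (update v z a) p g <-> holds (update v' z a) p g.
    by apply: IH => y gy; rewrite /update; case: eqVneq => // yz;
      apply: eqv; rewrite yz.
  by split=> H a; apply/upd.
- have upd a : holds (update v z a) p g <-> holds (update v' z a) p g.
    by apply: IH => y gy; rewrite /update; case: eqVneq => // yz;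
      apply: eqv; rewrite yz.
  by split=> -[a /upd H]; exists a.
Qed.

Lemma holds_formula (v : nat -> R) (p : X -> R) (f : formula) :
  holds v p f <-> sat p f.
Proof. by apply: eq_holds => y fy; have := formula_closed f y; rewrite fy. Qed.

End Formulas.

Definition DENNET (R : comNzRingType) : Prop :=
  forall (X : finType) (I : countType) (f_ : I -> formula R X) (f : formula R X),
    (forall p : X -> R, (forall i, sat p (f_ i)) -> sat p f) ->
    exists J : {fset I},
      forall p : X -> R, (forall i, i \in J -> sat p (f_ i)) -> sat p f.

(* Main.v *)
Require Import Defs.
From mathcomp Require Import all_boot all_order all_algebra.
From mathcomp Require Import finmap monalg.
From mathcomp Require Import reals.

(** The order of [R] is definable with one quantifier: [n <= x] holds exactly
    when [x = n + y ^ 2] has a solution [y]. So, in the single free variable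
    [x], the formulas [exists y, x = n + y ^ 2] ([n : nat]) cut out the
    decreasing half-lines [[n, +oo[]. Their intersection is empty because [R]
    is archimedean, so that together they imply a contradiction; but finitely
    many of them are all satisfied at any [x] above the relevant [n], so no
    finite subfamily does. Lemma [sat_nat_le] identifies the half-lines. *)

Set Implicit Arguments.
Unset Strict Implicit.
Unset Printing Implicit Defensive.

Import Order.TTheory GRing.Theory Num.Theory.
Local Open Scope ring_scope.

Section Polynomials.
Variables (R : comNzRingType) (X : finType).
Implicit Types (i : nat + X) (c : R) (m : {cmonom (nat + X)%type}).

Lemma occurs0 i : occurs i (0 : fpoly R X) = false.
Proof. by rewrite /occurs msupp0. Qed.

Lemma occursU i c m : occurs i << c *g m >> -> m i != 0%N.
Proof. by case/hasP=> m' /(fsubsetP msuppU_le); rewrite in_fset1 => /eqP ->. Qed.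

Lemma occursD i (w w' : fpoly R X) :
  occurs i (w + w') -> occurs i w || occurs i w'.
Proof.
case/hasP=> m /(fsubsetP (msuppD_le _ _)); rewrite in_fsetU => /orP[] wm mi.
  by apply/orP; left; apply/hasP; exists m.
by apply/orP; right; apply/hasP; exists m.
Qed.

Lemma pevalC (e : nat + X -> R) c : peval e (c%:MP : fpoly R X) = c.
Proof. by rewrite /peval mmapU mdom1 big_seq_fset0 mulr1. Qed.

Lemma pevalX (e : nat + X -> R) i : peval e << ucm i >> = e i.
Proof. by rewrite /peval mmapU mdomU big_seq_fset1 cmUU mul1r. Qed.

Lemma pevalX2 (e : nat + X -> R) i :
  peval e << mulcm (ucm i) (ucm i) >> = e i ^+ 2.
Proof.
by rewrite /peval mmapU mdomD fsetUid mdomU big_seq_fset1 mulcmE ucmE eqxx mul1r.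
Qed.

Lemma pevalCDX2 (e : nat + X -> R) c i :
  peval e (c%:MP + << mulcm (ucm i) (ucm i) >>) = c + e i ^+ 2.
Proof.
by rewrite /peval mmapD; congr (_ + _); [exact: pevalC | exact: pevalX2].
Qed.

End Polynomials.

Section Formulas.
Variable R : comNzRingType.

Definition nat_add_square_preform (n : nat) : preform R unit :=
  Fex 0%N (Feq << ucm (inr tt) >>
               (n%:R%:MP + << mulcm (ucm (inl 0%N)) (ucm (inl 0%N)) >>)).

Lemma nat_add_square_closed n y : ~~ freeY y (nat_add_square_preform n).
Proof.
rewrite /= negb_and negbK; case: eqVneq => //= y_neq0; rewrite negb_or.
apply/andP; split; first by apply/negP => /occursU; rewrite ucmE.
apply/negP => /occursD/orP[] /occursU; first by rewrite onecmE.
by rewrite mulcmE ucmE (inj_eq inl_inj) [0%N == y]eq_sym (negPf y_neq0).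
Qed.

Definition nat_add_square n : formula R unit :=
  Formula (nat_add_square_closed n).

Lemma sat_nat_add_square (p : unit -> R) n :
  sat p (nat_add_square n) <-> exists a, p tt = n%:R + a ^+ 2.
Proof.
rewrite /sat /=; split=> -[a Ha]; exists a; move: Ha;
  by rewrite pevalX pevalCDX2.
Qed.

Lemma false_closed y : ~~ freeY y (Fnot (Feq (0 : fpoly R unit) 0)).
Proof. by rewrite /= occurs0. Qed.

Definition false_formula : formula R unit := Formula false_closed.

Lemma sat_false (p : unit -> R) : ~ sat p false_formula.
Proof. by apply. Qed.

End Formulas.

(** Only here does [R] have to be real closed: a nonnegative [p tt - n%:R] must
    have a square root. *)
Lemma sat_nat_le (R : realType) (p : unit -> R) n :
  sat p (nat_add_square R n) <-> n%:R <= p tt.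
Proof.
rewrite sat_nat_add_square; split=> [[a ->]|le_np].
  by rewrite lerDl sqr_ge0.
exists (Num.sqrt (p tt - n%:R)).
by rewrite sqr_sqrtr ?subr_ge0 // addrC subrK.
Qed.

Theorem theorem2 (R : realType) : ~ DENNET R.
Proof.
move=> dennet.
have [|J finJ] := dennet unit nat (nat_add_square R) (false_formula R).
  move=> p all_ge; exfalso.
  have /sat_nat_le := all_ge (Num.bound `|p tt|).
  by rewrite leNgt (le_lt_trans (ler_norm _)) // archi_boundP ?normr_ge0.
(* Any upper bound of J would do as the value of x; the sum of J is one. *)
apply: (@sat_false R (fun=> (\sum_(i <- J) i)%:R)); apply: finJ => n Jn.
by apply/sat_nat_le; rewrite ler_nat (big_rem n) //= leq_addr.
Qed.
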